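(* Let $R_2$ be the class of functions $f$ which can be written (a.e.) as $f=f_1-f_2$ with $f_1,f_2\in R_1$ such that $\int f_1\,dx-\int f_2\,dx$ is well defined, and for such $f$ put $\int f\,dx:=\int f_1\,dx-\int f_2\,dx$. Then: (i) $\int f\,dx$ does not depend on the particular choice of $f_1$ and $f_2$. (ii) The integral on $R_2$ is an extension of the integral on $R_1$ (that is, $R_1\subset R_2$ and the two integrals agree on $R_1$). (iii) If $f,g\in R_2$ and $f\le g$ a.e., then $\int f\,dx\le\int g\,dx$. (iv) If $f\in R_2$ and $c\in\mathbb R$, then $cf\in R_2$ and $\int cf\,dx=c\int f\,dx$. (v) If $f,g\in R_2$ and $\int f\,dx+\int g\,dx$ is well defined, then $f+g\in R_2$ and $$\int (f+g)\,dx=\int f\,dx+\int g\,dx.$$ (vi) If $f,g\in R_2$, then $\max\{f,g\}$ and $\min\{f,g\}$ also belong to $R_2$.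
   Context: A set $N\subset\mathbb R$ is a null set if for each $\varepsilon>0$ it has a countable cover by intervals of total length $<\varepsilon$; a property holds almost everywhere (a.e.) if it holds outside a null set. Functions (with values in $[-\infty,\infty]$, defined a.e. on $\mathbb R$) that are equal a.e. are identified, and relations between functions are understood a.e. $f_n\nearrow f$ means that $f_n\le f_{n+1}$ for all $n$ and $f_n\to f$, a.e. A step function is a function of the form $\varphi=\sum_{i=1}^m c_i\chi_{I_i}$ with bounded intervals $I_i\subset\mathbb R$ and real numbers $c_i$; its integral is $\int\varphi\,dx:=\sum_{i=1}^m c_i|I_i|$, where $|I_i|$ is the length of $I_i$ (this does not depend on the representation). $R_0$ denotes the vector lattice of step functions. $R_1$ is the class of functions $f:\mathbb R\to[-\infty,\infty]$ for which there exists $(\varphi_n)\subset R_0$ with $\varphi_n\nearrow f$, and then $\int f\,dx:=\lim\int\varphi_n\,dx\in(-\infty,\infty]$ (this does not depend on the choice of $(\varphi_n)$). A sum or difference of extended real numbers is well defined if it is not of the form $\infty-\infty$ or $-\infty+\infty$. For $f_1,f_2\in R_1$, $\int f_1\,dx-\int f_2\,dx$ is thus well defined if and only if at least one of the two integrals is finite; in that case at least one of $f_1,f_2$ is finite a.e., so $f_1-f_2$ is defined a.e. Convention: $0\cdot(\pm\infty):=0$. *)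

(* Defs.v *)
From HB Require Import structures.
From mathcomp Require Import all_boot all_order all_algebra.
From mathcomp Require Import all_classical all_reals all_analysis.

Set Implicit Arguments.
Unset Strict Implicit.
Unset Printing Implicit Defensive.

Import Order.TTheory GRing.Theory Num.Theory.
Import numFieldNormedType.Exports.

Local Open Scope classical_set_scope.
Local Open Scope ring_scope.

(* A function defined a.e. with values in [-oo, +oo] is represented by a total
   function R -> \bar R; its values on a null set are irrelevant, since every
   notion below only involves functions through relations holding a.e. The
   library operations on \bar R are total: +oo - +oo has a junk value, and
   [x +? y] says that the sum x + y is well defined. *)

(* By [wlength_itv] this is b - a for a nonempty interval with end points
   a <= b in [-oo, +oo], and 0 for the empty set. *)
Definition itv_length (R : realType) (I : interval R) : \bar R :=
  wlength idfun [set` I].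

(* Finite covers are included, since some of the intervals may be empty. *)
Definition null_set (R : realType) (N : set R) : Prop :=
  forall e : R, 0 < e -> exists I : nat -> interval R,
    N `<=` \bigcup_n [set` I n] /\
    (\sum_(0 <= n <oo) itv_length (I n) < e%:E)%E.

Definition almost_everywhere_R (R : realType) (P : R -> Prop) : Prop :=
  exists2 N : set R, null_set N & forall x, ~ N x -> P x.

Notation "\ae x , P" := (almost_everywhere_R (fun x => P))
  (at level 200, x name, P at level 200).

Definition increases_to (R : realType) (f : nat -> R -> \bar R)
    (g : R -> \bar R) : Prop :=
  \ae x, (forall n, (f n x <= f n.+1 x)%E) /\ f n x @[n --> \oo] --> g x.

(* The list of the pairs (c_i, I_i) represents \sum_i c_i \chi_{I_i}. *)
Definition represents_step (R : realType) (s : seq (R * interval R))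
    (phi : R -> R) : Prop :=
  (forall p, p \in s -> bounded_set [set` p.2]) /\
  phi = (fun x => \sum_(p <- s) p.1 * \1_[set` p.2] x).

Definition R0 (R : realType) (phi : R -> R) : Prop :=
  exists s, represents_step s phi.

(* Here and below, [xget x0 A] is some element of A, or x0 if A is empty; it
   extracts an integral that does not depend on the choice being made. *)
Definition int0 (R : realType) (phi : R -> R) : R :=
  xget 0 [set r | exists2 s, represents_step s phi &
                  r = \sum_(p <- s) p.1 * fine (itv_length p.2)].

Definition R1_approx (R : realType) (f : R -> \bar R) (phi : nat -> R -> R) :
    Prop :=
  (forall n, R0 (phi n)) /\ increases_to (fun n => EFin \o phi n) f.

Definition R1 (R : realType) (f : R -> \bar R) : Prop :=
  exists phi, R1_approx f phi.

Definition int1 (R : realType) (f : R -> \bar R) : \bar R :=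
  xget 0%E [set v | exists2 phi, R1_approx f phi &
                    (int0 (phi n))%:E @[n --> \oo] --> v].

Local Open Scope ereal_scope.

Definition R2_decomp (R : realType) (f f1 f2 : R -> \bar R) : Prop :=
  [/\ R1 f1, R1 f2, int1 f1 +? - int1 f2 &
      \ae x, f1 x +? - f2 x /\ f x = f1 x - f2 x].

Definition R2 (R : realType) (f : R -> \bar R) : Prop :=
  exists f1 f2, R2_decomp f f1 f2.

Definition int2 (R : realType) (f : R -> \bar R) : \bar R :=
  xget 0 [set v | exists f1 f2,
    R2_decomp f f1 f2 /\ v = int1 f1 - int1 f2].

(* Main.v *)
(* Null sets are exactly the negligible sets of Lebesgue measure, and the
   integral of a step function is its Lebesgue integral. Dominated convergence
   then shows that the integral on R_1 is well defined and monotone, and Fatou's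
   lemma that f in R_1 is finite a.e. when its integral is finite. Since
   functions in R_1 and their integrals are > -oo, f1 - f2 <= g1 - g2 is
   equivalent to f1 + g2 <= g1 + f2, for functions and for integrals alike, so
   that additivity and monotonicity pass from R_1 to R_2. For (vi),
   max(f, g) = max(f1 + g2, g1 + f2) - (f2 + g2) if f2 and g2 have finite
   integrals, and max(f, g) = (f1 + g1) - min(f2 + g1, g2 + f1) otherwise. *)
Require Import Defs.
From HB Require Import structures.
From mathcomp Require Import all_boot all_order all_algebra.
From mathcomp Require Import all_classical all_reals all_analysis.
From mathcomp Require Import measurable_realfun ring lra.

Import Order.TTheory GRing.Theory Num.Theory.
Import numFieldNormedType.Exports.

Local Open Scope classical_set_scope.
Local Open Scope ring_scope.
Local Open Scope ereal_scope.

Local Notation mu := lebesgue_measure.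

(** * Null sets and Lebesgue measure *)

Lemma itv_lengthE (R : realType) (I : interval R) :
  itv_length I = mu [set` I].
Proof.
rewrite /itv_length wlength_itv lebesgue_measure_itv.
by case: I => [[b1 x|[|]] [b2 y|[|]]].
Qed.

(** Forward, intersecting over [k] the covers of total length below [1/(k+1)] gives a measurable set
    of measure 0 containing [N]. Backward, Lebesgue measure is an infimum over countable covers by
    half-open intervals, so a set of measure 0 has covers of arbitrarily small total length. *)
Lemma null_setP (R : realType) (N : set R) :
  Defs.null_set N <-> mu.-negligible N.
Proof.
split=> [N0|[A [mA A0 NA]] e e0].
- have /choice[I HI] k : exists I : nat -> interval R,
      N `<=` \bigcup_n [set` I n] /\
      \sum_(0 <= n <oo) itv_length (I n) < k.+1%:R^-1%:E.
    by apply: N0; rewrite invr_gt0.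
  have mU k : measurable (\bigcup_n [set` I k n] : set R).
    by apply: bigcup_measurable => n _; exact: measurable_itv.
  pose A : set R := \bigcap_k \bigcup_n [set` I k n].
  have mA : measurable A by exact: bigcapT_measurable.
  exists A; split=> //; last by move=> x Nx k _; exact: (HI k).1.
  apply/eqP; rewrite eq_le measure_ge0 andbT; apply/lee_addgt0Pr => e e0.
  rewrite add0e.
  have [k ke] : exists k : nat, (k.+1%:R^-1 < e)%R.
    have [k _ Hk] := near_infty_natSinv_lt (PosNum e0).
    by exists k; exact: Hk (leqnn k).
  apply: (@le_trans _ _ (mu (\bigcup_n [set` I k n] : set R))).
    by apply: le_measure; [exact: (mem_set mA)|exact: (mem_set (mU k))|move=> x /(_ k); apply].
  apply: (@le_trans _ _ (\sum_(0 <= n <oo) itv_length (I k n))); last first.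
    by apply/ltW/(lt_trans (HI k).2); rewrite lte_fin.
  under eq_eseriesr do rewrite itv_lengthE.
  have mI n : measurable ([set` I k n] : set R) by exact: measurable_itv.
  exact: (measure_sigma_subadditive mu mI (mU k) (@subset_refl _ _)).
- have : mu A < e%:E by rewrite A0 lte_fin.
  move=> /ereal_inf_lt[_ [F [mF AF] <-] Fe].
  have /choice[I HI] n : exists I : interval R, F n = [set` I].
    by have [p _ <-] := mF n; exists `]p.1, p.2]%R.
  exists I; split.
    by apply: (subset_trans NA); apply: (subset_trans AF) => x [n _];
      rewrite HI => ?; exists n.
  by move: Fe; under eq_eseriesr do rewrite HI.
Qed.

Lemma almost_everywhereP (R : realType) (P : R -> Prop) :
  almost_everywhere_R P <-> {ae mu, forall x, P x}.
Proof.
split=> [[N /null_setP N0 NP]|P0].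
- by apply: negligibleS N0 => x /= nPx; apply: contrapT => /NP.
- exists (~` [set x | P x]); first exact/null_setP.
  by move=> x /contrapT.
Qed.

(** * Step functions and their Lebesgue integral *)

Lemma bounded_itv_lengthK {R : realType} {I : interval R} :
  bounded_set [set` I] -> (fine (itv_length I))%:E = mu [set` I].
Proof.
(* Boundedness provides a bound for every number strictly above [M], but not for [M] itself; hence
   [M + 1]. *)
move=> [M [_ /(_ (M + 1)%R)]]; rewrite ltrDl ltr01 => /(_ isT) IM.
rewrite itv_lengthE fineK// ge0_fin_numE//.
apply: (@le_lt_trans _ _ (mu `[(- (M + 1))%R, (M + 1)%R]%classic)).
  apply: le_measure; [apply: mem_set; exact: measurable_itv ..|].
  by move=> x /IM /=; rewrite ler_norml in_itv.
by rewrite lebesgue_measure_itv /=; case: ifP => // _; rewrite -EFinB ltry.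
Qed.

Lemma integral_itv_step {R : realType} {c : R} {I : interval R} :
  bounded_set [set` I] ->
  mu.-integrable setT (fun x => (c * \1_[set` I] x)%:E) /\
  \int[mu]_x (c * \1_[set` I] x)%:E = (c * fine (itv_length I))%:E.
Proof.
move=> bI; have mI : measurable ([set` I] : set R) by exact: measurable_itv.
have eI : \int[mu]_x (\1_[set` I] x)%:E = (fine (itv_length I))%:E :> \bar R.
  by rewrite integral_indic// setIT; exact/esym/bounded_itv_lengthK.
have iI : mu.-integrable setT (fun x => (\1_[set` I] x)%:E : \bar R).
  apply/integrableP; split; first exact/measurable_EFinP/measurable_indic.
  under eq_integral do rewrite gee0_abs ?lee_fin//.
  by rewrite eI ltry.
split.
  under eq_fun do rewrite EFinM.
  exact: integrableZl.
under eq_integral do rewrite EFinM.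
by rewrite integralZl// eI -EFinM.
Qed.

(** The Lebesgue integral depends on [phi] only, so the sum of the [c_i |I_i|] is the same for every
    representation [s]. This is what makes [int0] meaningful. *)
Lemma represents_step_integral {R : realType} {s} {phi : R -> R} :
  represents_step s phi ->
  mu.-integrable setT (EFin \o phi) /\
  \int[mu]_x (phi x)%:E = (\sum_(p <- s) p.1 * fine (itv_length p.2))%:E.
Proof.
move=> [bs ->]; elim: s bs => [|p s IH] bs.
  rewrite (_ : EFin \o _ = cst 0); last by apply/funext => x; rewrite /= big_nil.
  split; first exact: integrable0.
  by under eq_integral do rewrite big_nil; rewrite big_nil integral0.
have [|IHi IHe] := IH; first by move=> q qs; apply: bs; rewrite inE qs orbT.
have [pi pe] := @integral_itv_step _ p.1 _ (bs p (mem_head _ _)).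
split.
  rewrite (_ : EFin \o _ = (fun x => (p.1 * \1_[set` p.2] x)%:E) \+
    (EFin \o (fun x => \sum_(q <- s) q.1 * \1_[set` q.2] x)%R)).
    exact: integrableD.
  by apply/funext => x /=; rewrite big_cons EFinD.
under eq_integral do rewrite big_cons EFinD.
by rewrite integralD// big_cons EFinD -pe -IHe.
Qed.

Lemma R0_integrable {R : realType} {phi : R -> R} :
  R0 phi -> mu.-integrable setT (EFin \o phi).
Proof. by move=> [s /represents_step_integral[]]. Qed.

Lemma R0_integral {R : realType} {phi : R -> R} :
  R0 phi -> \int[mu]_x (phi x)%:E = (int0 phi)%:E.
Proof.
move=> [s sphi]; rewrite /int0; case: xgetP => [r -> [t tphi ->]|/= H].
  by rewrite (represents_step_integral tphi).2.
by case: (H (\sum_(p <- s) p.1 * fine (itv_length p.2))%R); exists s.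
Qed.

(** * The vector lattice of step functions *)

Lemma R0_0 (R : realType) : R0 (fun=> 0%R : R).
Proof. by exists [::]; split=> //; apply/funext => x; rewrite big_nil. Qed.

Lemma R0D {R : realType} {phi psi : R -> R} :
  R0 phi -> R0 psi -> R0 (fun x => phi x + psi x)%R.
Proof.
move=> [s [bs ->]] [t [bt ->]]; exists (s ++ t); split.
  by move=> p; rewrite mem_cat => /orP[/bs|/bt].
by apply/funext => x; rewrite big_cat.
Qed.

Lemma R0Z {R : realType} (c : R) {phi : R -> R} :
  R0 phi -> R0 (fun x => c * phi x)%R.
Proof.
move=> [s [bs ->]]; exists [seq (c * p.1, p.2)%R | p <- s]; split.
  by move=> _ /mapP[p /bs bp ->].
apply/funext => x; rewrite big_map mulr_sumr; apply: eq_bigr => p _.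
by rewrite mulrA.
Qed.

Lemma represents_step_cons {R : realType} (p : R * interval R) s (psi : R -> R) :
  represents_step (p :: s) psi -> exists phi,
  [/\ represents_step s phi, bounded_set [set` p.2] &
      psi = (fun x => p.1 * \1_[set` p.2] x + phi x)%R].
Proof.
move=> [bs ->]; exists (fun x => \sum_(q <- s) q.1 * \1_[set` q.2] x)%R.
split; [split=> // q qs| |by apply/funext => x; rewrite big_cons].
  by apply: bs; rewrite inE qs orbT.
by apply: bs; rewrite mem_head.
Qed.

(** The indicator of [I] localises everything to a bounded set, so [h] may be arbitrary, even with
    [h 0 <> 0]. The induction peels off one term [c 1_J], using [1_I h(c 1_J + psi) = 1_(I & J) (h(c
    + psi) - h(psi)) + 1_I h(psi)]; both [h] and [I] change, so both are generalised. *)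
Lemma R0_itv_comp {R : realType} (h : R -> R) {I : interval R} {phi : R -> R} :
  bounded_set [set` I] -> R0 phi -> R0 (fun x => \1_[set` I] x * h (phi x))%R.
Proof.
move=> bI [s]; elim: s phi h I bI => [|p s IH] phi h I bI.
  move=> [_ ->]; exists [:: (h 0%R, I)]; split.
    by move=> q; rewrite inE => /eqP ->.
  by apply/funext => x; rewrite !big_cons !big_nil addr0 mulrC.
move=> /represents_step_cons[psi [spsi bp ->]].
have bIp : bounded_set [set` (I `&` p.2)%O].
  by rewrite set_itvI; case: bI => M [Mr HM]; exists M; split=> // y /HM Hy x [/Hy].
have := R0D (IH psi (fun y => h (p.1 + y) - h y)%R _ bIp spsi) (IH psi h _ bI spsi).
congr R0; apply/funext => x; rewrite set_itvI indicI /=.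
rewrite [\1_[set` p.2] x]indicE; case: (x \in _).
  by rewrite !mulr1 mulrBr subrK.
by rewrite !mulr0 mul0r !add0r.
Qed.

(** Since [h 0 = 0], the composite vanishes wherever [phi] does. The same peeling is used without
    [I]: [h(c 1_J + psi) = 1_J (h(c + psi) - h(psi)) + h(psi)], whose first term is localised to
    [J]. *)
Lemma R0_comp {R : realType} (h : R -> R) {phi : R -> R} :
  h 0%R = 0%R -> R0 phi -> R0 (h \o phi).
Proof.
move=> h0 [s]; elim: s phi => [|p s IH] phi.
  move=> [_ ->]; rewrite (_ : _ \o _ = fun=> 0%R); first exact: R0_0.
  by apply/funext => x; rewrite /= big_nil.
move=> /represents_step_cons[psi [spsi bp ->]].
have R0psi : R0 psi by exists s.
have := R0D (R0_itv_comp (fun y => h (p.1 + y) - h y)%R bp R0psi) (IH psi spsi).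
congr R0; apply/funext => x /=.
rewrite indicE; case: (x \in _); first by rewrite mulr1 mul1r subrK.
by rewrite mulr0 mul0r !add0r.
Qed.

Lemma R0_max {R : realType} {phi psi : R -> R} :
  R0 phi -> R0 psi -> R0 (fun x => Num.max (phi x) (psi x)).
Proof.
move=> R0phi R0psi.
(* This is [max(phi, psi) = phi + max(0, psi - phi)], and [max(0, _)] fixes 0. *)
have := R0D R0phi (R0_comp (Num.max 0%R) (maxxx _) (R0D R0psi (R0Z (-1) R0phi))).
by congr R0; apply/funext => x /=; rewrite addr_maxr addr0 mulN1r addrCA subrr addr0.
Qed.

Lemma R0_min {R : realType} {phi psi : R -> R} :
  R0 phi -> R0 psi -> R0 (fun x => Num.min (phi x) (psi x)).
Proof.
move=> R0phi R0psi.
have := R0Z (-1) (R0_max (R0Z (-1) R0phi) (R0Z (-1) R0psi)).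
by congr R0; apply/funext => x /=; rewrite !mulN1r -oppr_min opprK.
Qed.

Lemma int0D {R : realType} {phi psi : R -> R} : R0 phi -> R0 psi ->
  int0 (fun x => phi x + psi x)%R = (int0 phi + int0 psi)%R.
Proof.
move=> R0phi R0psi; apply: EFin_inj.
rewrite EFinD -!R0_integral//; last exact: R0D.
by under eq_integral do rewrite EFinD; rewrite integralD//; exact: R0_integrable.
Qed.

Lemma int0Z {R : realType} (c : R) {phi : R -> R} : R0 phi ->
  int0 (fun x => c * phi x)%R = (c * int0 phi)%R.
Proof.
move=> R0phi; apply: EFin_inj; rewrite EFinM -!R0_integral//; last exact: R0Z.
by under eq_integral do rewrite EFinM; rewrite integralZl//; exact: R0_integrable.
Qed.

(** * Almost everywhere reasoning and limits of step integrals *)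

Lemma ae_imply {R : realType} {P Q : R -> Prop} :
  (forall x, P x -> Q x) -> (\ae x, P x) -> \ae x, Q x.
Proof. by move=> PQ [N N0 NP]; exists N => // x /NP /PQ. Qed.

Lemma ae_forall {R : realType} {P : R -> Prop} : (forall x, P x) -> \ae x, P x.
Proof. 
move=> H; exists set0 => // e e0.
exists (fun=> `]0, 0[%R); split; first by move=> x.
rewrite eseries0 ?lte_fin// => n _ _.
by rewrite /itv_length set_itv_ge ?wlength0// bnd_simp ltxx. Qed.

Lemma ae_and {R : realType} {P Q : R -> Prop} :
  (\ae x, P x) -> (\ae x, Q x) -> \ae x, P x /\ Q x.
Proof.
move=> [N /null_setP N0 NP] [M /null_setP M0 MQ]; exists (N `|` M).
  by apply/null_setP; exact: negligibleU.
by move=> x /not_orP[/NP ? /MQ].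
Qed.

(* The functions (phi - psi_n)^+ converge to 0 a.e. and are dominated by the
   first of them. *)
Lemma step_le_lim {R : realType} {phi : R -> R} {psi : nat -> R -> R} {v : \bar R} :
  R0 phi -> (forall n, R0 (psi n)) ->
  (\ae x, (forall n, psi n x <= psi n.+1 x)%R /\
    exists2 l, (psi n x)%:E @[n --> \oo] --> l & (phi x)%:E <= l) ->
  (int0 (psi n))%:E @[n --> \oo] --> v -> (int0 phi)%:E <= v.
Proof.
move=> R0phi R0psi aepsi psiv.
pose h n x := Num.max 0%R (phi x - psi n x)%R.
have R0h n : R0 (h n).
  apply: R0_max; first exact: R0_0.
  have := R0D R0phi (R0Z (-1) (R0psi n)).
  by congr R0; apply/funext => x; rewrite mulN1r.
have h0 n x : (0 <= h n x)%R by rewrite le_max lexx.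
have [|||||_ _] := @dominated_convergence _ (measurableTypeR R) R mu setT measurableT
  (fun n => EFin \o h n) (cst 0) (EFin \o h 0%N).
- by move=> n; have /R0_integrable/integrableP[] := R0h n.
- exact: measurable_cst.
- apply/almost_everywhereP; apply: ae_imply aepsi => x [psi_nd [l psil phil]] _ /=.
  apply/fine_cvgP; split; first by near=> n.
  apply/cvgrPdist_le => e e0.
  (* As [phi x - e] lies strictly below the limit [l], even if [l] is infinite, [psi n x] eventually
     exceeds it, and then [h n x <= e]. *)
  have : (phi x - e)%:E < l.
    by apply: lt_le_trans phil; rewrite lte_fin ltrBlDr ltrDl.
  move=> phiel.
  have : \forall n \near \oo, (phi x - e)%:E < (psi n x)%:E.
    exact: (psil _ (open_ereal_gt' phiel)).
  apply: filterS => n; rewrite lte_fin => Hn /=.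
  rewrite sub0r normrN ger0_norm//; rewrite ge_max (ltW e0) /=; lra.
- exact: R0_integrable.
- apply/almost_everywhereP; apply: ae_imply aepsi => x [psi_nd _] n _ /=.
  rewrite lee_fin ger0_norm// /h ge_max le_max lexx /= le_max.
  apply/orP; right; rewrite lerB//.
  elim: n => // n IH; exact: le_trans IH (psi_nd n).
rewrite integral0 => h_cvg.
have {}h_cvg : (int0 (h n))%:E @[n --> \oo] --> (0 : \bar R).
  suff <- : (fun n => \int[mu]_x (h n x)%:E) = (fun n => (int0 (h n))%:E) by [].
  by apply/funext => n; exact: R0_integral.
(* By construction [phi <= psi n + h n] everywhere, so the integral of [phi] is at most the sum of
   the two integrals, which tends to [v + 0]. *)
have : (int0 (psi n) + int0 (h n))%:E @[n --> \oo] --> v + 0.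
  under eq_fun do rewrite EFinD.
  by apply: cvgeD => //; exact: fin_num_adde_defl.
rewrite adde0; apply: cvge_ge; near=> n.
rewrite -int0D// -!R0_integral//; last exact: R0D.
apply: le_integral => //; [exact: R0_integrable|apply: R0_integrable; exact: R0D|].
by move=> x _; rewrite lee_fin -lerBlDl le_max lexx orbT.
Unshelve. all: by end_near. Qed.

Lemma int0_le {R : realType} {phi psi : R -> R} : R0 phi -> R0 psi ->
  (\ae x, phi x <= psi x)%R -> (int0 phi <= int0 psi)%R.
Proof.
move=> R0phi R0psi lephi; rewrite -lee_fin.
apply: (@step_le_lim _ _ (fun=> psi)) => //; last exact: cvg_cst.
apply: ae_imply lephi => x phix; split=> //.
by exists (psi x)%:E; [exact: cvg_cst|rewrite lee_fin].
Qed.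

(** * The integral on [R1] *)

Lemma approx_int0_nd {R : realType} {f : R -> \bar R} {phi} :
  R1_approx f phi -> nondecreasing_seq (fun n => (int0 (phi n))%:E).
Proof.
move=> [R0phi phif]; apply/nondecreasing_seqP => n; rewrite lee_fin.
by apply: int0_le => //; apply: ae_imply phif => x [/(_ n) + _]; rewrite lee_fin.
Qed.

(** Each fixed [phi n] lies a.e. below [f <= g], the limit of [psi], so [step_le_lim] bounds its
    integral by [w]; then [n] tends to infinity. *)
Lemma approx_int0_le_lim {R : realType} {f g : R -> \bar R} {phi psi v w} :
  R1_approx f phi -> R1_approx g psi -> (\ae x, f x <= g x) ->
  (int0 (phi n))%:E @[n --> \oo] --> v ->
  (int0 (psi n))%:E @[n --> \oo] --> w -> v <= w.
Proof.
move=> [R0phi phif] [R0psi psig] fg phiv psiw.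
apply: cvge_le phiv; near=> n; apply: (step_le_lim (R0phi n) R0psi _ psiw).
apply: ae_imply (ae_and fg (ae_and phif psig)) => x [fgx [[phind phix] [psind psix]]].
split=> [k|]; first by have := psind k; rewrite lee_fin.
exists (g x) => //; apply: le_trans fgx.
apply: cvge_ge phix; exists n => // k /= nk.
have /nondecreasing_seqP H : forall n, (EFin \o phi n) x <= (EFin \o phi n.+1) x by [].
exact: H.
Unshelve. all: by end_near. Qed.

(** The integrals increase, so they have an extended real limit. Comparing two approximations of [f]
    in both directions shows that the value picked by [xget] is this limit, whichever sequence is
    used. *)
Lemma int1_cvg {R : realType} {f : R -> \bar R} {phi} :
  R1_approx f phi -> (int0 (phi n))%:E @[n --> \oo] --> int1 f.
Proof.
move=> fphi; have /cvg_ex[v phiv] := ereal_nondecreasing_is_cvgn (approx_int0_nd fphi).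
rewrite /int1; case: xgetP => [w _ [psi fpsi psiw]|/(_ v)[]]; last by exists phi.
have ff : \ae x, f x <= f x by exact: ae_forall.
suff <- : v = w by [].
apply/eqP; rewrite eq_le (approx_int0_le_lim fphi fpsi ff phiv psiw).
exact: (approx_int0_le_lim fpsi fphi ff psiw phiv).
Qed.

Lemma int1_le {R : realType} {f g : R -> \bar R} : R1 f -> R1 g ->
  (\ae x, f x <= g x) -> int1 f <= int1 g.
Proof.
move=> [phi fphi] [psi gpsi] fg.
exact: (approx_int0_le_lim fphi gpsi fg (int1_cvg fphi) (int1_cvg gpsi)).
Qed.

(** The real-valued [phi 0] is a lower bound. With its analogue for integrals, this excludes [-oo],
    so that sums within [R1] are always well defined. *)
Lemma R1_gtNy {R : realType} {f : R -> \bar R} : R1 f -> \ae x, -oo < f x.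
Proof.
move=> [phi [_ phif]]; apply: ae_imply phif => x [phind phix].
apply: lt_le_trans (ltNyr (phi 0%N x)) _.
have /nondecreasing_seqP H := phind.
apply: cvge_ge phix; exists 0%N => // k _; exact: (H 0%N k).
Qed.

Lemma int1_gtNy {R : realType} {f : R -> \bar R} : R1 f -> -oo < int1 f.
Proof.
move=> [phi fphi]; apply: lt_le_trans (ltNyr (int0 (phi 0%N))) _.
apply: cvge_ge (int1_cvg fphi).
by exists 0%N => // k _; exact: (approx_int0_nd fphi).
Qed.

Lemma approx_eq_int1 {R : realType} {f : R -> \bar R} {phi v} :
  R1_approx f phi -> (int0 (phi n))%:E @[n --> \oo] --> v -> int1 f = v.
Proof. by move=> /int1_cvg; exact: cvg_unique. Qed.

(** * Operations on [R1] and finiteness of its functions *)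

Lemma R1_0 (R : realType) : R1 (fun=> 0 : \bar R) /\ int1 (fun=> 0 : \bar R) = 0.
Proof.
have H : R1_approx (fun=> 0 : \bar R) (fun _ _ => 0%R).
  split=> [n|]; first exact: R0_0.
  by apply: ae_forall => x; split=> //; exact: cvg_cst.
split; first by exists (fun _ _ => 0%R).
apply: approx_eq_int1 H _.
rewrite (_ : (fun _ => _) = cst 0); first exact: cvg_cst.
by apply/funext => n; rewrite -R0_integral ?integral0//; exact: R0_0.
Qed.

Lemma R1_approxD {R : realType} {f g : R -> \bar R} {phi psi} :
  R1_approx f phi -> R1_approx g psi ->
  R1_approx (fun x => f x + g x) (fun n x => phi n x + psi n x)%R.
Proof.
move=> fphi gpsi.
have fNy : \ae x, -oo < f x by apply: R1_gtNy; exists phi.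
have gNy : \ae x, -oo < g x by apply: R1_gtNy; exists psi.
case: fphi gpsi => [R0phi phif] [R0psi psig]; split=> [n|]; first exact: R0D.
apply: ae_imply (ae_and (ae_and fNy gNy) (ae_and phif psig)).
move=> x [[fx gx] [[phind phix] [psind psix]]]; split=> [n|] /=.
  by rewrite !EFinD leeD//; [exact: phind|exact: psind].
under eq_fun do rewrite EFinD.
by apply: cvgeD => //; case: (f x) (g x) fx gx => [?| |] [?| |].
Qed.

Lemma R1D {R : realType} {f g : R -> \bar R} :
  R1 f -> R1 g -> R1 (fun x => f x + g x).
Proof. by move=> [phi fphi] [psi gpsi]; eexists; exact: R1_approxD fphi gpsi. Qed.

Lemma int1D {R : realType} {f g : R -> \bar R} :
  R1 f -> R1 g -> int1 (fun x => f x + g x) = int1 f + int1 g.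
Proof.
move=> R1f R1g; have := int1_gtNy R1f; have := int1_gtNy R1g.
case: R1f R1g => [phi fphi] [psi gpsi] fNy gNy.
apply: approx_eq_int1 (R1_approxD fphi gpsi) _.
under eq_fun => n.
  rewrite int0D; [|exact: fphi.1|exact: gpsi.1]; rewrite EFinD; over.
apply: cvgeD; [|exact: int1_cvg..].
by case: (int1 f) (int1 g) fNy gNy => [?| |] [?| |].
Qed.

Lemma R1_approxZ {R : realType} {c : R} {f : R -> \bar R} {phi} :
  (0 <= c)%R -> R1_approx f phi ->
  R1_approx (fun x => c%:E * f x) (fun n x => c * phi n x)%R.
Proof.
move=> c0 [R0phi phif]; split=> [n|]; first exact: R0Z.
apply: ae_imply phif => x [phind phix]; split=> [n|] /=.
  by rewrite !EFinM lee_wpmul2l//; exact: phind.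
by under eq_fun do rewrite EFinM; exact: cvgeZl.
Qed.

Lemma R1Z {R : realType} {c : R} {f : R -> \bar R} :
  (0 <= c)%R -> R1 f -> R1 (fun x => c%:E * f x).
Proof. by move=> c0 [phi fphi]; eexists; exact: R1_approxZ c0 fphi. Qed.

Lemma int1Z {R : realType} {c : R} {f : R -> \bar R} :
  (0 <= c)%R -> R1 f -> int1 (fun x => c%:E * f x) = c%:E * int1 f.
Proof.
move=> c0 [phi fphi]; apply: approx_eq_int1 (R1_approxZ c0 fphi) _.
under eq_fun => n do (rewrite int0Z; last exact: fphi.1); under eq_fun do rewrite EFinM.
by apply: cvgeZl => //; exact: int1_cvg.
Qed.

Lemma R1_approx_max {R : realType} {f g : R -> \bar R} {phi psi} :
  R1_approx f phi -> R1_approx g psi ->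
  R1_approx (fun x => maxe (f x) (g x)) (fun n x => Num.max (phi n x) (psi n x)).
Proof.
move=> [R0phi phif] [R0psi psig]; split=> [n|]; first exact: R0_max.
apply: ae_imply (ae_and phif psig) => x [[phind phix] [psind psix]]; split=> [n|] /=.
  rewrite !EFin_max ge_max !le_max; apply/andP; split; apply/orP.
    by left; exact: phind.
  by right; exact: psind.
under eq_fun do rewrite EFin_max.
exact: (@continuous2_cvg _ _ _ _ _ _ _ _ Order.max _ _ (@max_continuous _ _ (f x, g x)) phix psix).
Qed.

Lemma R1_max {R : realType} {f g : R -> \bar R} :
  R1 f -> R1 g -> R1 (fun x => maxe (f x) (g x)).
Proof. by move=> [phi fphi] [psi gpsi]; eexists; exact: R1_approx_max fphi gpsi. Qed.

Lemma R1_approx_min {R : realType} {f g : R -> \bar R} {phi psi} :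
  R1_approx f phi -> R1_approx g psi ->
  R1_approx (fun x => mine (f x) (g x)) (fun n x => Num.min (phi n x) (psi n x)).
Proof.
move=> [R0phi phif] [R0psi psig]; split=> [n|]; first exact: R0_min.
apply: ae_imply (ae_and phif psig) => x [[phind phix] [psind psix]]; split=> [n|] /=.
  rewrite !EFin_min le_min !ge_min; apply/andP; split; apply/orP.
    by left; exact: phind.
  by right; exact: psind.
under eq_fun do rewrite EFin_min.
exact: (@continuous2_cvg _ _ _ _ _ _ _ _ Order.min _ _ (@min_continuous _ _ (f x, g x)) phix psix).
Qed.

Lemma R1_min {R : realType} {f g : R -> \bar R} :
  R1 f -> R1 g -> R1 (fun x => mine (f x) (g x)).
Proof. by move=> [phi fphi] [psi gpsi]; eexists; exact: R1_approx_min fphi gpsi. Qed.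

(** Subtracting [phi 0] gives nonnegative functions [h n] with integrals bounded by a finite number.
    By Fatou their limit inferior [G] is integrable, hence finite a.e., whereas [G] would be [+oo]
    wherever [f] is. *)
Lemma R1_lty {R : realType} {f : R -> \bar R} :
  R1 f -> int1 f < +oo -> \ae x, f x < +oo.
Proof.
move=> [phi fphi] fy; have [R0phi phif] := fphi.
(* [phi 0 <= phi n] holds only a.e.; the positive part makes [h n] nonnegative everywhere. *)
pose h n x := Num.max 0%R (phi n x - phi 0%N x)%R.
have R0B n : R0 (fun x => phi n x - phi 0%N x)%R.
  have := R0D (R0phi n) (R0Z (-1) (R0phi 0%N)).
  by congr R0; apply/funext => x; rewrite mulN1r.
have R0h n : R0 (h n) by apply: R0_max => //; exact: R0_0.
have phi0 : \ae x, forall n, (phi 0%N x <= phi n x)%R.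
  apply: ae_imply phif => x [phind _] n; rewrite -lee_fin.
  by have /nondecreasing_seqP H := phind; exact: (H 0%N n).
(* Almost everywhere [h n + phi 0 = phi n], whose integral is at most that of [f]. *)
have int_h n : \int[mu]_x (h n x)%:E <= int1 f - (int0 (phi 0%N))%:E.
  rewrite R0_integral// leeBrDr// -EFinD -int0D//.
  apply: (@le_trans _ _ (int0 (phi n))%:E).
    rewrite lee_fin; apply: int0_le => //; first exact: R0D.
    apply: ae_imply phi0 => x /(_ n) phi0x.
    by rewrite /h max_r ?subr_ge0// subrK.
  apply: cvge_ge (int1_cvg fphi); exists n => // k /= nk.
  exact: (approx_int0_nd fphi).
have mh n : measurable_fun setT (EFin \o h n : measurableTypeR R -> \bar R).
  by have /R0_integrable/integrableP[] := R0h n.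
pose G (x : measurableTypeR R) := limn_einf (fun n => (h n x)%:E).
have G0 x : 0 <= G x.
  rewrite /G limn_einf_lim; apply: lime_ge; first exact: is_cvg_einfs.
  by near=> n; apply: le_ereal_inf_tmp => _ [k _ <-]; rewrite lee_fin le_max lexx.
(* The limit inferior unfolds to minus the limit superior of the negated sequence. *)
have mG : measurable_fun setT G.
  apply: (measurableT_comp (@oppe_measurable R setT)).
  apply: measurable_fun_limn_esup => n.
  exact: (measurableT_comp (@oppe_measurable R setT) (mh n)).
have iG : mu.-integrable setT G.
  apply/integrableP; split=> //.
  under eq_integral do rewrite gee0_abs//.
  apply: le_lt_trans (fatou mu measurableT mh _) _.
    by move=> n x _; rewrite lee_fin le_max lexx.
  apply: (@le_lt_trans _ _ (int1 f - (int0 (phi 0%N))%:E)); last first.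
    by rewrite lteBlDr// lty.
  rewrite limn_einf_lim; apply: lime_le; first exact: is_cvg_einfs.
  near=> n; apply: ge_ereal_inf; exists (\int[mu]_x (h n x)%:E) ; [by exists n => /=|exact: int_h].
have aG : \ae x, G x \is a fin_num.
  have /almost_everywhereP aG : {ae mu, forall x : R, setT x -> G x \is a fin_num}.
    exact: (@integrable_ae _ (measurableTypeR R) R mu setT measurableT G iG).
  by apply: ae_imply aG => x; apply.
apply: ae_imply (ae_and aG (ae_and phi0 phif)) => x [Gx [phi0x [_ phix]]].
rewrite ltey; apply/eqP => fxy; move: Gx; rewrite /G.
suff /cvg_limn_einf_sup[-> _] : (h n x)%:E @[n --> \oo] --> +oo by [].
have -> : (fun n => (h n x)%:E) = (fun n => (phi n x)%:E + (- phi 0%N x)%:E).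
  by apply/funext => n; rewrite /h max_r ?subr_ge0.
have -> : +oo = f x + (- phi 0%N x)%:E by rewrite fxy.
by apply: cvgeD => //; [rewrite fxy|exact: cvg_cst].
Unshelve. all: by end_near. Qed.

(** * Decompositions of functions in [R2] *)

Lemma leB_cross {R : realType} {a1 a2 b1 b2 : \bar R} :
  -oo < a1 -> -oo < a2 -> -oo < b1 -> -oo < b2 ->
  a1 +? - a2 -> b1 +? - b2 -> (a1 - a2 <= b1 - b2) = (a1 + b2 <= b1 + a2).
Proof.
case: a1 a2 b1 b2 => [a1| |] [a2| |] [b1| |] [b2| |] //= _ _ _ _ _ _.
- by rewrite !lee_fin; apply/idP/idP; lra.
- by rewrite !addye// !leey.
- by rewrite addeNy addey// leey; exact: leNye.
- by rewrite addeNy !addye// !leey.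
Qed.

(** A function of [R1] with finite integral is finite a.e., and [-oo] never occurs. Hence one finite
    integral yields both well-definedness conditions, for the integrals and pointwise. *)
Lemma R2_decompI {R : realType} {f f1 f2 : R -> \bar R} :
  R1 f1 -> R1 f2 -> int1 f1 < +oo \/ int1 f2 < +oo ->
  (\ae x, f x = f1 x - f2 x) -> R2_decomp f f1 f2.
Proof.
move=> R1f1 R1f2 fin fE; split=> //.
  case: fin (int1_gtNy R1f1) (int1_gtNy R1f2);
  by case: (int1 f1) (int1 f2) => [?| |] [?| |].
have afin : \ae x, f1 x < +oo \/ f2 x < +oo.
  case: fin => [/(R1_lty R1f1)|/(R1_lty R1f2)]; apply: ae_imply => x; first by left.
  by right.
apply: ae_imply (ae_and fE (ae_and afin (ae_and (R1_gtNy R1f1) (R1_gtNy R1f2)))).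
move=> x [-> [fin_x [f1x f2x]]]; split=> //.
by case: fin_x f1x f2x; case: (f1 x) (f2 x) => [?| |] [?| |].
Qed.

Lemma R2_decomp_lty {R : realType} {f f1 f2 : R -> \bar R} :
  R2_decomp f f1 f2 -> int1 f1 < +oo \/ int1 f2 < +oo.
Proof.
move=> [R1f1 R1f2 + _]; move: (int1_gtNy R1f1) (int1_gtNy R1f2).
by case: (int1 f1) (int1 f2) => [?| |] [?| |]; rewrite ?ltry; auto.
Qed.

Lemma R2_decomp_le {R : realType} {f g f1 f2 g1 g2 : R -> \bar R} :
  R2_decomp f f1 f2 -> R2_decomp g g1 g2 -> (\ae x, f x <= g x) ->
  int1 f1 - int1 f2 <= int1 g1 - int1 g2.
Proof.
move=> [R1f1 R1f2 intf fE] [R1g1 R1g2 intg gE] fg.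
(* Once the differences are cleared, only integrals of functions in [R1] are compared; the required
   pointwise inequality comes from [f <= g] by the same equivalence. *)
rewrite leB_cross//; try exact: int1_gtNy.
rewrite -!int1D//; apply: int1_le; [exact: R1D..|].
have aNy := ae_and (ae_and (R1_gtNy R1f1) (R1_gtNy R1f2))
                   (ae_and (R1_gtNy R1g1) (R1_gtNy R1g2)).
apply: ae_imply (ae_and aNy (ae_and fg (ae_and fE gE))).
move=> x [[[f1x f2x] [g1x g2x]] [fgx [[df fx] [dg gx]]]].
by rewrite -leB_cross// -fx -gx.
Qed.

(** This is monotonicity applied to [f <= f] in both directions. *)
Lemma R2_decomp_uniq {R : realType} {f f1 f2 g1 g2 : R -> \bar R} :
  R2_decomp f f1 f2 -> R2_decomp f g1 g2 ->
  int1 f1 - int1 f2 = int1 g1 - int1 g2.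
Proof.
move=> d d'; have ff : \ae x, f x <= f x by exact: ae_forall.
by apply/eqP; rewrite eq_le !(R2_decomp_le d d' ff, R2_decomp_le d' d ff).
Qed.

Lemma int2E {R : realType} {f f1 f2 : R -> \bar R} :
  R2_decomp f f1 f2 -> int2 f = int1 f1 - int1 f2.
Proof.
move=> d; rewrite /int2; case: xgetP => [_ _ [g1 [g2 [d' ->]]]|].
  exact: R2_decomp_uniq d' d.
by move=> /(_ (int1 f1 - int1 f2))[]; exists f1, f2.
Qed.

Lemma R1_decomp {R : realType} {f : R -> \bar R} :
  R1 f -> R2_decomp f f (fun=> 0).
Proof.
move=> R1f; have [R10 int10] := R1_0 R.
by apply: R2_decompI => //; [right; rewrite int10|apply: ae_forall => x; rewrite sube0].
Qed.

Lemma R2_decompN {R : realType} {f f1 f2 : R -> \bar R} :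
  R2_decomp f f1 f2 -> R2_decomp (fun x => - f x) f2 f1.
Proof.
move=> d; have [R1f1 R1f2 _ fE] := d; apply: R2_decompI => //.
  by have [] := R2_decomp_lty d; [right|left].
by apply: ae_imply fE => x [fx ->]; rewrite oppeB// addeC.
Qed.

Lemma R2_decompZ {R : realType} {c : R} {f f1 f2 : R -> \bar R} :
  (0 <= c)%R -> R2_decomp f f1 f2 ->
  R2_decomp (fun x => c%:E * f x) (fun x => c%:E * f1 x) (fun x => c%:E * f2 x).
Proof.
move=> c0 d; have [R1f1 R1f2 _ fE] := d; apply: R2_decompI; [exact: R1Z..| |].
  rewrite !int1Z//.
  have [] := R2_decomp_lty d => fy; [left|right]; rewrite lte_mul_pinfty ?lee_fin//.
by apply: ae_imply fE => x [fx ->]; rewrite muleDr// muleN.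
Qed.

Lemma R2N {R : realType} {f : R -> \bar R} : R2 f -> R2 (fun x => - f x).
Proof. by move=> [f1 [f2 /R2_decompN d]]; exists f2, f1. Qed.

Lemma int2N {R : realType} {f : R -> \bar R} :
  R2 f -> int2 (fun x => - f x) = - int2 f.
Proof.
move=> [f1 [f2 d]]; rewrite (int2E d) (int2E (R2_decompN d)).
by case: d => _ _ d _; rewrite oppeB// addeC.
Qed.

Lemma R2Z_ge0 {R : realType} {c : R} {f : R -> \bar R} : (0 <= c)%R -> R2 f ->
  R2 (fun x => c%:E * f x) /\ int2 (fun x => c%:E * f x) = c%:E * int2 f.
Proof.
move=> c0 [f1 [f2 d]]; have d' := R2_decompZ c0 d; split; first by do 2 eexists; exact: d'.
rewrite (int2E d) (int2E d'); case: d => R1f1 R1f2 d _.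
by rewrite !int1Z// muleDr// muleN.
Qed.

Lemma R2Z {R : realType} {c : R} {f : R -> \bar R} : R2 f ->
  R2 (fun x => c%:E * f x) /\ int2 (fun x => c%:E * f x) = c%:E * int2 f.
Proof.
have [c0|c0] := leP 0%R c; first exact: R2Z_ge0.
move=> R2f; have Nc0 : (0 <= - c)%R by rewrite oppr_ge0 ltW.
(* Scaling keeps functions in [R1] only for nonnegative factors, so the sign of [c] is moved to [f],
   where negation swaps the two parts of a decomposition. *)
have -> : (fun x => c%:E * f x) = (fun x => (- c)%:E * - f x).
  by apply/funext => x; rewrite EFinN muleNN.
have [? ->] := R2Z_ge0 Nc0 (R2N R2f); split=> //.
by rewrite int2N// EFinN muleNN.
Qed.

Lemma R2_decompD {R : realType} {f g f1 f2 g1 g2 : R -> \bar R} :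
  R2_decomp f f1 f2 -> R2_decomp g g1 g2 -> int2 f +? int2 g ->
  (\ae x, f x +? g x) /\
  R2_decomp (fun x => f x + g x) (fun x => f1 x + g1 x) (fun x => f2 x + g2 x).
Proof.
move=> df dg; rewrite (int2E df) (int2E dg).
have [R1f1 R1f2 intf fE] := df; have [R1g1 R1g2 intg gE] := dg => fg.
(* If [f1] and [g2] both had infinite integral, then [int2 f = +oo] and [int2 g = -oo], which is
   excluded; likewise for [f2] and [g1]. So infinite integrals occur only among the minuends or only
   among the subtrahends. *)
have fin : (int1 f1 < +oo /\ int1 g1 < +oo) \/ (int1 f2 < +oo /\ int1 g2 < +oo).
  move: intf intg fg (int1_gtNy R1f1) (int1_gtNy R1f2) (int1_gtNy R1g1) (int1_gtNy R1g2).
  case: (int1 f1) (int1 f2) (int1 g1) (int1 g2) => [?| |] [?| |] [?| |] [?| |] //=;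
  by rewrite ?ltry; auto.
have afin : \ae x, (f1 x < +oo /\ g1 x < +oo) \/ (f2 x < +oo /\ g2 x < +oo).
  case: fin => -[fy gy]; [move: (ae_and (R1_lty R1f1 fy) (R1_lty R1g1 gy))
    |move: (ae_and (R1_lty R1f2 fy) (R1_lty R1g2 gy))]; apply: ae_imply => x; first by left.
  by right.
have aNy := ae_and (ae_and (R1_gtNy R1f1) (R1_gtNy R1f2))
                   (ae_and (R1_gtNy R1g1) (R1_gtNy R1g2)).
have afg : \ae x, f x +? g x /\ f x + g x = f1 x + g1 x - (f2 x + g2 x).
  apply: ae_imply (ae_and aNy (ae_and afin (ae_and fE gE))).
  move=> x [[[+ +] [+ +]] [+ [[+ ->] [+ ->]]]].
  case: (f1 x) (f2 x) (g1 x) (g2 x) => [a| |] [b| |] [c| |] [d| |] //=;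
    try by move=> _ _ _ _ [[]|[]].
  by move=> *; split=> //; congr EFin; ring.
split; first by apply: ae_imply afg => x [].
apply: R2_decompI; [exact: R1D..| |by apply: ae_imply afg => x []].
by rewrite !int1D//; case: fin => -[? ?]; [left|right]; rewrite lte_add_pinfty.
Qed.

Lemma R2D {R : realType} {f g : R -> \bar R} :
  R2 f -> R2 g -> int2 f +? int2 g ->
  [/\ \ae x, f x +? g x, R2 (fun x => f x + g x) &
      int2 (fun x => f x + g x) = int2 f + int2 g].
Proof.
move=> [f1 [f2 df]] [g1 [g2 dg]] fg; have [afg d] := R2_decompD df dg fg.
split=> //; first by eexists; eexists; exact: d.
move: fg; rewrite (int2E d) (int2E df) (int2E dg).
case: d df dg => _ _ + _ [R1f1 R1f2 + _] [R1g1 R1g2 + _]; rewrite !int1D//.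
move: (int1_gtNy R1f1) (int1_gtNy R1f2) (int1_gtNy R1g1) (int1_gtNy R1g2).
case: (int1 f1) (int1 f2) (int1 g1) (int1 g2) => [?| |] [?| |] [?| |] [?| |] //= *.
by congr EFin; ring.
Qed.

(** * Maximum and minimum in [R2] *)

Lemma maxeB {R : realType} {a1 a2 b1 b2 : \bar R} :
  -oo < a1 -> -oo < a2 -> -oo < b1 -> -oo < b2 -> a2 < +oo -> b2 < +oo ->
  maxe (a1 - a2) (b1 - b2) = maxe (a1 + b2) (b1 + a2) - (a2 + b2).
Proof.
case: a1 a2 b1 b2 => [a1| |] [a2| |] [b1| |] [b2| |] //= _ _ _ _ _ _.
(* Translation by the finite number [a2 + b2] commutes with the maximum. *)
- rewrite -!EFinD -!EFin_max -EFinD addr_maxl; congr EFin.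
  by congr Num.max; ring.
- by rewrite !addye// !maxey.
Qed.

(* Unlike [maxeB], this applies when b1 = a2 = +oo with a1 and b2 finite, i.e.,
   to the maximum of a function whose integral may be -oo and a function whose
   integral may be +oo. *)
Lemma maxeB_min {R : realType} {a1 a2 b1 b2 : \bar R} :
  -oo < a1 -> -oo < a2 -> -oo < b1 -> -oo < b2 ->
  [\/ a1 < +oo /\ b1 < +oo, a1 < +oo /\ b2 < +oo | a2 < +oo /\ b1 < +oo] ->
  maxe (a1 - a2) (b1 - b2) = (a1 + b1) - mine (a2 + b1) (b2 + a1).
Proof.
case: a1 a2 b1 b2 => [a1| |] [a2| |] [b1| |] [b2| |] //= _ _ _ _;
  try by move=> [[]|[]|[]].
all: move=> _; rewrite ?addye ?addey ?addeNy ?addNye ?maxey ?maxye ?maxeNy ?maxNye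
  ?miney ?minye//.
  rewrite -!EFinD -EFin_max -EFin_min -EFinB oppr_min addr_maxr; congr EFin.
  by congr Num.max; ring.
all: by rewrite -!EFinD; congr EFin; ring.
Qed.

Lemma R2_max {R : realType} {f g : R -> \bar R} :
  R2 f -> R2 g -> R2 (fun x => maxe (f x) (g x)).
Proof.
move=> [f1 [f2 df]] [g1 [g2 dg]].
have [R1f1 R1f2 _ fE] := df; have [R1g1 R1g2 _ gE] := dg.
have aNy := ae_and (ae_and (R1_gtNy R1f1) (R1_gtNy R1f2))
                   (ae_and (R1_gtNy R1g1) (R1_gtNy R1g2)).
(* Each decomposition has a part with finite integral. If only the subtrahends are known to be
   finite, [maxeB] applies; the other three combinations are the cases of [maxeB_min]. *)
have : int1 f2 < +oo /\ int1 g2 < +oo \/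
    [\/ int1 f1 < +oo /\ int1 g1 < +oo, int1 f1 < +oo /\ int1 g2 < +oo |
        int1 f2 < +oo /\ int1 g1 < +oo].
  have [fy|fy] := R2_decomp_lty df; have [gy|gy] := R2_decomp_lty dg.
  - by right; constructor 1.
  - by right; constructor 2.
  - by right; constructor 3.
  - by left.
case=> [[f2y g2y]|fin].
- exists (fun x => maxe (f1 x + g2 x) (g1 x + f2 x)), (fun x => f2 x + g2 x).
  apply: R2_decompI; [|exact: R1D| |].
  + by apply: R1_max; exact: R1D.
  + by right; rewrite int1D// lte_add_pinfty.
  + apply: ae_imply (ae_and aNy (ae_and (ae_and (R1_lty R1f2 f2y) (R1_lty R1g2 g2y))
      (ae_and fE gE))).
    by move=> x [[[? ?] [? ?]] [[? ?] [[_ ->] [_ ->]]]]; exact: maxeB.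
- have R1min : R1 (fun x => mine (f2 x + g1 x) (g2 x + f1 x)).
    by apply: R1_min; exact: R1D.
  exists (fun x => f1 x + g1 x), (fun x => mine (f2 x + g1 x) (g2 x + f1 x)).
  apply: R2_decompI => //; first exact: R1D.
  + case: fin => -[? ?].
    * by left; rewrite int1D// lte_add_pinfty.
    (* In the mixed cases one argument of the minimum has finite integral, which bounds that of the
       minimum. *)
    * right; apply: (@le_lt_trans _ _ (int1 (fun x => g2 x + f1 x))).
        apply: int1_le => //; first exact: R1D.
        by apply: ae_forall => x; rewrite ge_min lexx orbT.
      by rewrite int1D// lte_add_pinfty.
    * right; apply: (@le_lt_trans _ _ (int1 (fun x => f2 x + g1 x))).
        apply: int1_le => //; first exact: R1D.
        by apply: ae_forall => x; rewrite ge_min lexx.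
      by rewrite int1D// lte_add_pinfty.
  + have afin : \ae x, [\/ f1 x < +oo /\ g1 x < +oo, f1 x < +oo /\ g2 x < +oo |
        f2 x < +oo /\ g1 x < +oo].
      case: fin => -[fy gy].
      * apply: ae_imply (ae_and (R1_lty R1f1 fy) (R1_lty R1g1 gy)) => x H.
        by constructor 1.
      * apply: ae_imply (ae_and (R1_lty R1f1 fy) (R1_lty R1g2 gy)) => x H.
        by constructor 2.
      * apply: ae_imply (ae_and (R1_lty R1f2 fy) (R1_lty R1g1 gy)) => x H.
        by constructor 3.
    apply: ae_imply (ae_and aNy (ae_and afin (ae_and fE gE))).
    by move=> x [[[? ?] [? ?]] [? [[_ ->] [_ ->]]]]; exact: maxeB_min.
Qed.

Lemma R2_min {R : realType} {f g : R -> \bar R} :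
  R2 f -> R2 g -> R2 (fun x => mine (f x) (g x)).
Proof.
move=> R2f R2g; have := R2N (R2_max (R2N R2f) (R2N R2g)).
by congr R2; apply/funext => x; rewrite oppe_max !oppeK.
Qed.

Theorem proposition4p1 (R : realType) :
  (forall f f1 f2 g1 g2 : R -> \bar R,
     R2_decomp f f1 f2 -> R2_decomp f g1 g2 ->
     int1 f1 - int1 f2 = int1 g1 - int1 g2) /\
  (forall f : R -> \bar R, R1 f -> R2 f /\ int2 f = int1 f) /\
  (forall f g : R -> \bar R, R2 f -> R2 g ->
     (\ae x, f x <= g x) -> int2 f <= int2 g) /\
  (forall (f : R -> \bar R) (c : R), R2 f ->
     R2 (fun x => c%:E * f x) /\ int2 (fun x => c%:E * f x) = c%:E * int2 f) /\
  (forall f g : R -> \bar R, R2 f -> R2 g -> int2 f +? int2 g ->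
     [/\ \ae x, f x +? g x,
         R2 (fun x => f x + g x) &
         int2 (fun x => f x + g x) = int2 f + int2 g]) /\
  (forall f g : R -> \bar R, R2 f -> R2 g ->
     R2 (fun x => maxe (f x) (g x)) /\ R2 (fun x => mine (f x) (g x))).
Proof.
split; first by move=> f f1 f2 g1 g2; exact: R2_decomp_uniq.
split.
  move=> f R1f; have d := R1_decomp R1f; split; first by do 2 eexists; exact: d.
  by rewrite (int2E d) (R1_0 R).2 sube0.
split.
  move=> f g [f1 [f2 df]] [g1 [g2 dg]] fg.
  by rewrite (int2E df) (int2E dg); exact: R2_decomp_le df dg fg.
split; first by move=> f c; exact: R2Z.
split; first by move=> f g; exact: R2D.
by move=> f g R2f R2g; split; [exact: R2_max|exact: R2_min].
Qed.
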